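(* Let $(A,A')$ be a filtered opca and $U\subseteq A$ a downwards closed subset with $U\cap A'=\emptyset$. Then the structure $K(A,A',U)$ (defined in the context) is an abstract Krivine structure.
   Context: Filtered opcas. Application associates to the left; $xy\leq z$ includes that $xy$ is defined. An opca is a poset $(A,\leq)$ with a partial binary application $a,b\mapsto ab$ such that: (i) if $ab$ is defined, $a'\leq a$ and $b'\leq b$, then $a'b'$ is defined and $a'b'\leq ab$; (ii) there are $\mathsf{k},\mathsf{s}\in A$ such that $\mathsf{k}xy\leq x$ for all $x,y$; $\mathsf{s}xy$ is defined for all $x,y$; and whenever $xz(yz)$ is defined, $\mathsf{s}xyz\leq xz(yz)$. A filtered opca $(A,A')$ is an opca $A$ with a subset $A'\subseteq A$ closed under (defined) application and containing choices for $\mathsf{k},\mathsf{s}$. For an application term $t$ in variables $x_1,\dots,x_n$ with constants from $A$, $\langle x_1\cdots x_n\rangle t$ denotes an element of $A$ (in $A'$ if the constants of $t$ are in $A'$) such that $(\langle x_1\cdots x_n\rangle t)a_1\cdots a_{n-1}$ is always defined and $(\langle x_1\cdots x_n\rangle t)a_1\cdots a_n\leq t[a_1,\dots,a_n]$ whenever the latter is defined. Abstract Krivine structure. An aks consists of: a set $\Lambda$ with a binary operation $t,s\mapsto t\cdot s$ and elements $\mathsf{K},\mathsf{S},\mathsf{cc}\in\Lambda$; a subset $\mathsf{QP}\subseteq\Lambda$ containing $\mathsf{K},\mathsf{S},\mathsf{cc}$ and closed under $\cdot$; a set $\Pi$ with operations $\Lambda\times\Pi\to\Pi$, $(t,\pi)\mapsto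 t.\pi$ (associated to the right) and $\Pi\to\Lambda$, $\pi\mapsto k_\pi$; and a subset $\perp\!\!\!\perp\ \subseteq\Lambda\times\Pi$ such that for all $t,s,u\in\Lambda$, $\pi,\pi'\in\Pi$: (S1) $(t,s.\pi)\in\perp\!\!\!\perp$ implies $(t\cdot s,\pi)\in\perp\!\!\!\perp$; (S2) $(t,\pi)\in\perp\!\!\!\perp$ implies $(\mathsf{K},t.s.\pi)\in\perp\!\!\!\perp$; (S3) $((t\cdot u)\cdot(s\cdot u),\pi)\in\perp\!\!\!\perp$ implies $(\mathsf{S},t.s.u.\pi)\in\perp\!\!\!\perp$; (S4) $(t,k_\pi.\pi)\in\perp\!\!\!\perp$ implies $(\mathsf{cc},t.\pi)\in\perp\!\!\!\perp$; (S5) $(t,\pi)\in\perp\!\!\!\perp$ implies $(k_\pi,t.\pi')\in\perp\!\!\!\perp$. Sequence coding. Fix numerals $\bar{n}\in A'$ ($n\in\mathbb{N}$), a coding of finite sequences $(a_0,\dots,a_{n-1})$ of elements of $A$ by elements $[a_0,\dots,a_{n-1}]\in A$, and elements $\mathsf{b},\mathsf{c},\mathsf{d},\mathsf{t}\in A'$ such that: $\mathsf{b}\bar{n}[a_0,\dots,a_k]\leq a_n$ for $n\leq k$; $\mathsf{c}\bar{n}[a_0,\dots,a_k]\leq[a_n,\dots,a_k]$ for $n\leq k+1$ (the empty sequence if $n=k+1$); $\mathsf{d}a[a_0,\dots,a_{n-1}]\leq[a,a_0,\dots,a_{n-1}]$, and the left-hand side is itself a coded sequence; $\mathsf{t}a\leq[a]$.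 Such data exist. Write $\pi_i=\mathsf{b}\bar{i}\pi$ and $\pi_{\geq j}=\mathsf{c}\bar{j}\pi$. The structure $K(A,A',U)$: $\Lambda=A$, $\mathsf{QP}=A'$, $\Pi$ is the set of coded sequences, $a.\pi=\mathsf{d}a\pi$. The operation is $a\cdot b=\langle\pi\rangle a(b.\pi)$, precisely $a\cdot b=Mab$ with $M=\langle xy\pi\rangle x(\mathsf{d}y\pi)\in A'$. Further $k_\pi=\langle\rho\rangle\rho_0\pi$, precisely $k_\pi=\kappa\pi$ with $\kappa=\langle\pi\rho\rangle\rho_0\pi\in A'$, and $$\mathsf{K}=\langle\pi\rangle\pi_0\pi_{\geq2},\quad \mathsf{S}=\langle\pi\rangle((\pi_0\cdot\pi_2)\cdot(\pi_1\cdot\pi_2))\pi_{\geq3},\quad \mathsf{cc}=\langle\pi\rangle\pi_0(k_{\pi_{\geq1}}.\pi_{\geq1}),$$ where within these terms $x\cdot y$, $k_x$, $x.y$ stand for the application terms $Mxy$, $\kappa x$, $\mathsf{d}xy$. Finally $\perp\!\!\!\perp\ =\{(t,\pi)\in A\times\Pi\mid t\pi\text{ is defined and }t\pi\in U\}$. *)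

(* Defs.v *)
From mathcomp Require Import all_boot all_order.
From mathcomp Require Import boolp classical_sets.

Set Implicit Arguments.
Unset Strict Implicit.
Unset Printing Implicit Defensive.

Import Order.TTheory.

Local Open Scope classical_set_scope.
Local Open Scope order_scope.

(* [o ⊑ z] is the convention "xy <= z includes that xy is defined". *)
Definition defined_le d (P : porderType d) (o : option P) (z : P) : bool :=
  if o is Some x then x <= z else false.
Notation "o ⊑ z" := (defined_le o z) (at level 70, no associativity).

Definition lift_app T (ap : T -> T -> option T) (o o' : option T) : option T :=
  if o is Some x then if o' is Some y then ap x y else None else None.

(* [apps ap f [:: a1; ...; an]] is f a1 ... an, associated to the left. *)
Definition apps T (ap : T -> T -> option T) (f : T) (s : seq T) : option T :=
  foldl (fun o x => lift_app ap o (Some x)) (Some f) s.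

Section Combinators.
Context (d : Order.disp_t) (P : porderType d) (ap : P -> P -> option P).

Definition is_k (k : P) : Prop := forall x y : P, apps ap k [:: x; y] ⊑ x.

Definition is_s (s : P) : Prop :=
  (forall x y : P, apps ap s [:: x; y]) /\
  (forall x y z w : P,
     lift_app ap (ap x z) (ap y z) = Some w -> apps ap s [:: x; y; z] ⊑ w).

End Combinators.

Record opca (d : Order.disp_t) := Opca {
  opca_sort :> porderType d;
  app : opca_sort -> opca_sort -> option opca_sort;
  app_mono : forall a b c a' b' : opca_sort,
    app a b = Some c -> a' <= a -> b' <= b -> app a' b' ⊑ c;
  opca_ks : exists k s : opca_sort, is_k app k /\ is_s app s
}.

Record opca_filter d (A : opca d) (A' : set A) : Prop := OpcaFilter {
  filter_app : forall a b c : A, app a b = Some c -> A' a -> A' b -> A' c;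
  filter_ks : exists k s : A, [/\ A' k, A' s, is_k (@app d A) k & is_s (@app d A) s]
}.

Inductive term (T : Type) (n : nat) : Type :=
| TVar of 'I_n
| TCst of T
| TApp of term T n & term T n.

Arguments TVar {T n} _.
Arguments TCst {T n} _.

Fixpoint eval d (A : opca d) n (a : n.-tuple A) (t : term A n) : option A :=
  match t with
  | TVar i => Some (tnth a i)
  | TCst c => Some c
  | TApp t u => lift_app (@app d A) (eval a t) (eval a u)
  end.

Fixpoint consts_in T n (B : set T) (t : term T n) : Prop :=
  match t with
  | TVar _ => True
  | TCst c => B c
  | TApp t u => consts_in B t /\ consts_in B u
  end.

(* A choice of an element <x_1 ... x_m> t for every term t and every m = n.+1. *)
Record bracket d (A : opca d) (A' : set A) := Bracket {
  abstr : forall n, term A n.+1 -> A;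
  abstr_def : forall n (t : term A n.+1) (a : n.-tuple A),
    apps (@app d A) (abstr t) a;
  abstr_le : forall n (t : term A n.+1) (a : n.+1.-tuple A) (z : A),
    eval a t = Some z -> apps (@app d A) (abstr t) a ⊑ z;
  abstr_in : forall n (t : term A n.+1), consts_in A' t -> A' (abstr t)
}.

Record seq_coding d (A : opca d) (A' : set A) := SeqCoding {
  numeral : nat -> A;
  code : seq A -> A;
  seqb : A;
  seqc : A;
  seqd : A;
  seqt : A;
  numeral_in : forall n, A' (numeral n);
  seqb_in : A' seqb;
  seqc_in : A' seqc;
  seqd_in : A' seqd;
  seqt_in : A' seqt;
  seqb_le : forall (x0 : A) (n : nat) (s : seq A), (n < size s)%N ->
    apps (@app d A) seqb [:: numeral n; code s] ⊑ nth x0 s n;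
  seqc_le : forall (n : nat) (s : seq A), (0 < size s)%N -> (n <= size s)%N ->
    apps (@app d A) seqc [:: numeral n; code s] ⊑ code (drop n s);
  seqd_le : forall (a : A) (s : seq A),
    apps (@app d A) seqd [:: a; code s] ⊑ code (a :: s);
  seqd_coded : forall (a : A) (s : seq A),
    exists s' : seq A, apps (@app d A) seqd [:: a; code s] = Some (code s');
  seqt_le : forall a : A, app seqt a ⊑ code [:: a]
}.

(* [Lam] is Lambda and [Stk] is Pi; [kapp t s] is t . s (application),
   [push t p] is t.p, [cont p] is k_p, and [pole] is the orthogonality relation. *)
Record krivine_data := KrivineData {
  Lam : Type;
  Stk : Type;
  kapp : Lam -> Lam -> Lam;
  push : Lam -> Stk -> Stk;
  cont : Stk -> Lam;
  kK : Lam;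
  kS : Lam;
  kcc : Lam;
  QP : set Lam;
  pole : set (Lam * Stk)
}.

Record is_aks (X : krivine_data) : Prop := IsAks {
  aks_K : QP (kK X);
  aks_S : QP (kS X);
  aks_cc : QP (kcc X);
  aks_app : forall t s : Lam X, QP t -> QP s -> QP (kapp t s);
  aks_S1 : forall (t s : Lam X) (p : Stk X),
    pole (t, push s p) -> pole (kapp t s, p);
  aks_S2 : forall (t s : Lam X) (p : Stk X),
    pole (t, p) -> pole (kK X, push t (push s p));
  aks_S3 : forall (t s u : Lam X) (p : Stk X),
    pole (kapp (kapp t u) (kapp s u), p) ->
    pole (kS X, push t (push s (push u p)));
  aks_S4 : forall (t : Lam X) (p : Stk X),
    pole (t, push (cont p) p) -> pole (kcc X, push t p);
  aks_S5 : forall (t : Lam X) (p p' : Stk X),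
    pole (t, p) -> pole (cont p, push t p')
}.

Definition the_value T (o : option T) : o -> T :=
  match o return o -> T with
  | Some x => fun=> x
  | None => fun h => False_rect T (notF h)
  end.

Lemma the_valueE T (o : option T) (h : o) : o = Some (the_value h).
Proof. by case: o h. Qed.

Section Construction.
Context (d : Order.disp_t) (A : opca d) (A' : set A).
Context (br : bracket A') (sc : seq_coding A').

Local Notation "t @@ u" := (TApp t u) (at level 40, left associativity).
Local Notation var n i := (TVar (@Ordinal n i isT)).
Local Notation num i := (TCst (numeral sc i)).

(* [tentry i p] is p_i and [tdrop j p] is p_{>= j}. *)
Definition tentry n (i : nat) (t : term A n) : term A n :=
  TCst (seqb sc) @@ num i @@ t.
Definition tdrop n (j : nat) (t : term A n) : term A n :=
  TCst (seqc sc) @@ num j @@ t.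
Definition tpush n (t u : term A n) : term A n := TCst (seqd sc) @@ t @@ u.

(* M = <x y p> x (d y p) *)
Definition combM : A :=
  abstr br (var 3 0 @@ tpush (var 3 1) (var 3 2)).

(* kappa = <p r> r_0 p *)
Definition combkappa : A :=
  abstr br (tentry 0 (var 2 1) @@ var 2 0).

Definition tkapp n (t u : term A n) : term A n := TCst combM @@ t @@ u.
Definition tcont n (t : term A n) : term A n := TCst combkappa @@ t.

Definition combK : A :=
  abstr br (let p := var 1 0 in tentry 0 p @@ tdrop 2 p).

Definition combS : A :=
  abstr br (let p := var 1 0 in
    tkapp (tkapp (tentry 0 p) (tentry 2 p))
          (tkapp (tentry 1 p) (tentry 2 p)) @@ tdrop 3 p).

Definition combcc : A :=
  abstr br (let p := var 1 0 in
    tentry 0 p @@ tpush (tcont (tdrop 1 p)) (tdrop 1 p)).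

Definition coded_seq : Type := range (code sc).

Lemma combM_def (a b : A) : apps (@app d A) combM [:: a; b].
Proof. exact: (abstr_def br _ [tuple a; b]). Qed.

Lemma combkappa_def (a : A) : app combkappa a.
Proof. exact: (abstr_def br _ [tuple a]). Qed.

Lemma push_def (a : A) (p : coded_seq) : apps (@app d A) (seqd sc) [:: a; val p].
Proof. by have [s _ <-] := set_valP p; have [s' ->] := seqd_coded sc a s. Qed.

Lemma push_range (a : A) (p : coded_seq) :
  the_value (push_def a p) \in range (code sc).
Proof.
apply/mem_set; have [s _ es] := set_valP p.
have [s' es'] := seqd_coded sc a s; exists s' => //.
by apply: Some_inj; rewrite -the_valueE -es' es.
Qed.

Definition krivine_structure (U : set A) : krivine_data := {|
  Lam := A;
  Stk := coded_seq;
  kapp := fun a b => the_value (combM_def a b);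
  push := fun a p => exist _ (the_value (push_def a p)) (push_range a p);
  cont := fun p => the_value (combkappa_def (val p));
  kK := combK;
  kS := combS;
  kcc := combcc;
  QP := A';
  pole := [set tp | exists2 u, app tp.1 (val tp.2) = Some u & U u]
|}.

End Construction.

(* Main.v *)
Require Import Defs.
From mathcomp Require Import all_boot all_order.
From mathcomp Require Import boolp classical_sets.

(** [K], [S], [cc], [kapp t s] and [k_p] all come from bracket abstractions, so
    applying one of them to a stack gives something below the value of its
    defining term.  That value is compared with the process named in the
    hypothesis of the axiom: projecting a stack [t.s.p] returns elements below
    [t], [s] and [p], and every operation that can occur in a term
    (application, push, [kapp], [cont]) is monotone, with definedness passing
    downwards ([lift_app_le]).  Hence whenever the hypothesis puts a defined
    value [u] in [U], the process in the conclusion is defined and below [u],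
    and [U], being downwards closed, contains it.  Membership in [QP] holds
    because the constants of all these terms lie in the filter, which is closed
    under application.

    The one delicate point is that pushing [a] on the stack coded by [s] need
    not give the code of [a :: s], but only some coded sequence below it.  So
    stacks are never computed, only bounded above by codes ([push_le_code]);
    since the projections are monotone, an upper bound is all that is used.
    The monotonicity lemmas ([eval_app_le] to [eval_cont_le]) follow the syntax
    of terms, which makes each axiom a direct reading of the term defining its
    combinator. *)

Set Implicit Arguments.
Unset Strict Implicit.
Unset Printing Implicit Defensive.

Import Order.TTheory.
Local Open Scope classical_set_scope.
Local Open Scope order_scope.

Lemma defined_le_trans (d : Order.disp_t) (P : porderType d) (o : option P)
  (x y : P) : o ⊑ x -> x <= y -> o ⊑ y.
Proof. by case: o => //= z; apply: le_trans. Qed.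

Lemma defined_leE (d : Order.disp_t) (P : porderType d) (o : option P)
  (h : o) (z : P) : (o ⊑ z) = (the_value h <= z).
Proof. by case: o h. Qed.

Lemma the_value_le (d : Order.disp_t) (P : porderType d) (o : option P)
  (h : o) : o ⊑ the_value h.
Proof. by rewrite defined_leE. Qed.

Section Evaluation.
Context (d : Order.disp_t) (A : opca d).

(** The closure of application under smaller arguments, extended to arguments
    that are themselves values of partial expressions. *)
Lemma lift_app_le (o o' : option A) (x y z : A) :
  o ⊑ x -> o' ⊑ y -> app x y ⊑ z -> lift_app (@app d A) o o' ⊑ z.
Proof.
case: o o' => [a|] [b|] //= ax yb; case E: (app x y) => [c|] //= cz.
exact: defined_le_trans (app_mono E ax yb) cz.
Qed.

Lemma lift_app_value (o : option A) (h : o) (x : A) :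
  lift_app (@app d A) o (Some x) = app (the_value h) x.
Proof. by case: o h. Qed.

Lemma eval_app_le n (v : n.-tuple A) (t u : term A n) (a b z : A) :
  eval v t ⊑ a -> eval v u ⊑ b -> app a b ⊑ z -> eval v (TApp t u) ⊑ z.
Proof. exact: lift_app_le. Qed.

(** Isolated because the projections, push and [kapp] are all given by a
    constant applied to two terms, and their specifications bound the whole
    expression without naming the intermediate value [f a]. *)
Lemma eval_app2_le n (v : n.-tuple A) (f : A) (t u : term A n) (a b z : A) :
  eval v t ⊑ a -> eval v u ⊑ b -> apps (@app d A) f [:: a; b] ⊑ z ->
  eval v (TApp (TApp (TCst f) t) u) ⊑ z.
Proof.
rewrite /apps /= => ta ub; case E: (app f a) => [g|] //= gb.
by apply: (lift_app_le _ ub gb); apply: (@lift_app_le (Some f) _ f a);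
  rewrite ?E /=.
Qed.

Lemma eval_var_le n (v : n.-tuple A) (i : 'I_n) (z : A) :
  tnth v i <= z -> eval v (TVar i) ⊑ z.
Proof. by []. Qed.

Lemma abstr_eval_le (A' : set A) (br : bracket A') n (t : term A n.+1)
  (v : n.+1.-tuple A) (z : A) :
  eval v t ⊑ z -> apps (@app d A) (abstr br t) v ⊑ z.
Proof.
case E: (eval v t) => [w|] //= wz.
exact: defined_le_trans (abstr_le br E) wz.
Qed.

Lemma abstr1_eval_le (A' : set A) (br : bracket A') (t : term A 1) (x z : A) :
  eval [tuple x] t ⊑ z -> app (abstr br t) x ⊑ z.
Proof. exact: abstr_eval_le. Qed.

End Evaluation.

Section Krivine.
Context (d : Order.disp_t) (A : opca d) (A' : set A).
Context (br : bracket A') (sc : seq_coding A') (U : set A).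

Local Notation KS := (krivine_structure br sc U).

Lemma eval_entry_le n (v : n.-tuple A) (t : term A n) i (x0 : A) (s : seq A) :
  (i < size s)%N -> eval v t ⊑ code sc s ->
  eval v (tentry sc i t) ⊑ nth x0 s i.
Proof.
by move=> lti ts; apply: (eval_app2_le _ ts (seqb_le sc x0 lti)) => /=.
Qed.

Lemma eval_drop_le n (v : n.-tuple A) (t : term A n) (r s : seq A) :
  (0 < size r)%N -> eval v t ⊑ code sc (r ++ s) ->
  eval v (tdrop sc (size r) t) ⊑ code sc s.
Proof.
move=> r0 ts; rewrite -[s in code sc s](drop_size_cat s (erefl (size r))).
apply: (eval_app2_le (a := numeral sc (size r)) _ ts) => //=.
by apply: seqc_le; rewrite size_cat ?leq_addr ?ltn_addr.
Qed.

Lemma eval_push_le n (v : n.-tuple A) (t u : term A n) (a : Lam KS)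
  (p : Stk KS) :
  eval v t ⊑ a -> eval v u ⊑ val p ->
  eval v (tpush sc t u) ⊑ val (push a p).
Proof.
move=> ta up; exact: eval_app2_le ta up (the_value_le (push_def a p)).
Qed.

Lemma eval_kapp_le n (v : n.-tuple A) (t u : term A n) (a b : Lam KS) :
  eval v t ⊑ a -> eval v u ⊑ b -> eval v (tkapp br sc t u) ⊑ kapp a b.
Proof.
move=> ta ub; exact: eval_app2_le ta ub (the_value_le (combM_def br sc a b)).
Qed.

Lemma eval_cont_le n (v : n.-tuple A) (t : term A n) (p : Stk KS) :
  eval v t ⊑ val p -> eval v (tcont br sc t) ⊑ cont p.
Proof.
move=> tp; apply: (@eval_app_le _ _ _ _ _ _ (combkappa br sc) (val p)) => //=.
exact: the_value_le.
Qed.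

Lemma stack_code (p : Stk KS) :
  exists2 s, code sc s = val p & val p <= code sc s.
Proof. by have [s _ sp] := set_valP p; exists s; rewrite sp. Qed.

(** An inequality is the most one can ask: the coding only provides that the
    result of a push is some coded sequence below the expected one.  The
    hypothesis is an inequality too, so that the bound can be iterated through
    successive pushes. *)
Lemma push_le_code (a : Lam KS) (p : Stk KS) (s : seq A) :
  val p <= code sc s -> val (push a p) <= code sc (a :: s).
Proof.
move=> ps.
rewrite /= -defined_leE.
exact: (eval_app2_le (v := [tuple]) (t := TCst a) (u := TCst (val p))
         (lexx _) ps (seqd_le sc a s)).
Qed.

Lemma pole_bounded (t : Lam KS) (p : Stk KS) :
  pole (t, p) -> exists2 u, app t (val p) ⊑ u & U u.
Proof. by case=> u /= tp Uu; exists u; rewrite // tp /=. Qed.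

Lemma pole_le (t : Lam KS) (p : Stk KS) (u : A)
  (U_down : forall x y : A, y <= x -> U x -> U y) :
  app t (val p) ⊑ u -> U u -> pole (t, p).
Proof.
rewrite /pole /=; case E: (app t (val p)) => [w|] //= wu Uu.
by exists w => //; apply: U_down Uu.
Qed.

End Krivine.

Theorem theorem2p5 (d : Order.disp_t) (A : opca d) (A' : set A)
    (hA : opca_filter A') (br : bracket A') (sc : seq_coding A')
    (U : set A)
    (U_down : forall x y : A, (y <= x)%O -> U x -> U y)
    (U_disj : (U `&` A' = set0)%classic) :
  is_aks (krivine_structure br sc U).
Proof.
have inb := seqb_in sc; have inc := seqc_in sc; have ind := seqd_in sc.
have inn := numeral_in sc.
have inM : A' (combM br sc) by apply: abstr_in; do !split.
have inkappa : A' (combkappa br sc) by apply: abstr_in; do !split.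
split.
- by apply: abstr_in; do !split.
- by apply: abstr_in; do !split.
- by apply: abstr_in; do !split.
- move=> t s; rewrite /QP /= => At As.
  have := the_valueE (combM_def br sc t s).
  rewrite {1}/apps /=; case E: (app (combM br sc) t) => [Mt|] //= EMts.
  exact: filter_app hA _ _ _ EMts (filter_app hA E inM At) As.
- move=> t s p /pole_bounded[u tsp Uu].
  apply: pole_le U_down _ Uu.
  have : apps (@app d A) (combM br sc) [tuple t; s; val p] ⊑ u.
    apply: abstr_eval_le.
    apply: (eval_app_le (a := t) (b := val (push s p))).
    + exact: eval_var_le.
    + by apply: eval_push_le; apply: eval_var_le.
    + exact: tsp.
  by rewrite -(lift_app_value (combM_def br sc t s)).
- move=> t s p /pole_bounded[u tp Uu]; apply: pole_le U_down _ Uu.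
  have [q qp pq] := stack_code p.
  have bound := push_le_code t (push_le_code s pq).
  apply: abstr1_eval_le.
  apply: (eval_app_le (a := t) (b := val p)).
  + exact: (eval_entry_le t (s := [:: t, s & q])).
  + rewrite -qp.
    exact: (eval_drop_le (r := [:: t; s])).
  + exact: tp.
- move=> t s w p /pole_bounded[u tp Uu]; apply: pole_le U_down _ Uu.
  have [q qp pq] := stack_code p.
  have bound := push_le_code t (push_le_code s (push_le_code w pq)).
  apply: abstr1_eval_le.
  apply: (eval_app_le _ _ (b := val p)); last exact: tp.
  + do 2!apply: eval_kapp_le.
    * exact: (eval_entry_le t (s := [:: t, s, w & q])).
    * exact: (eval_entry_le t (i := 2) (s := [:: t, s, w & q])).
    * exact: (eval_entry_le t (i := 1) (s := [:: t, s, w & q])).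
    * exact: (eval_entry_le t (i := 2) (s := [:: t, s, w & q])).
  + rewrite -qp.
    exact: (eval_drop_le (r := [:: t; s; w])).
- move=> t p /pole_bounded[u tp Uu]; apply: pole_le U_down _ Uu.
  have [q qp pq] := stack_code p.
  have bound := push_le_code t pq.
  have rest : eval [tuple val (push t p)] (tdrop sc 1 (TVar ord0)) ⊑ val p.
    rewrite -qp.
    exact: (eval_drop_le (r := [:: t])).
  apply: abstr1_eval_le.
  apply: (eval_app_le (a := t) (b := val (push (cont p) p))).
  + exact: (eval_entry_le t (s := t :: q)).
  + apply: eval_push_le; last exact: rest.
    exact: eval_cont_le.
  + exact: tp.
- move=> t p p' /pole_bounded[u tp Uu]; apply: pole_le U_down _ Uu.
  have [q _ pq] := stack_code p'.
  have bound := push_le_code t pq.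
  have : apps (@app d A) (combkappa br sc) [tuple val p; val (push t p')] ⊑ u.
    apply: abstr_eval_le.
    apply: (eval_app_le (a := t) (b := val p)).
    + exact: (eval_entry_le t (s := t :: q)).
    + exact: eval_var_le.
    + exact: tp.
  by rewrite -(lift_app_value (combkappa_def br sc (val p))).
Qed.
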